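(* Let $X_t=e^{Y_t}$ be an exponential Lévy process with characteristic exponent $\phi$, let $f(x)=x^\beta$ and $g(X_t,t)=e^{-ct}f(X_t)=e^{-ct}X_t^\beta$ with $c>0$, and assume $\phi_1(\beta)<0$ and $\phi_2(2\beta)<0$, where $\phi_1(\cdot):=\phi(\cdot)-c$ and $\phi_2(\cdot):=\phi(\cdot)-2c$. Let $\lambda>0$, and let $Q^*$ be the optimal randomization distribution for the problem $$\inf_{Q\in\mathcal{M}(\mathbb{R}^+)}\left\{\operatorname{Var}\left(\int_0^\infty g(X_s,s)\frac{1_{\{N>s\}}}{Q(N>s)}\,ds\right)+\lambda\,\mathbb{E}^Q[N]\right\}.$$ Then under $Q^*$, $N$ is a shifted exponential random variable with the probability density function given by $$q^*(s):=|\phi_2(2\beta)|\sqrt{\frac{1}{2\lambda|\phi_1(\beta)|}}\;e^{-\frac12|\phi_2(2\beta)|s}\,1_{\{s>s^*\}},$$ where the optimal shift $s^*$ is given by $$s^*:=\begin{cases}0 & \text{if }\lambda\ge\frac{2}{|\phi_1(\beta)|},\\ -\frac{1}{|\phi_2(2\beta)|}\log\left(\frac12\lambda|\phi_1(\beta)|\right) & \text{if }\lambda<\frac{2}{|\phi_1(\beta)|}.\end{cases}$$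
   Context: $Y=\{Y_t:t\ge0\}$ is a Lévy process and $\phi$ denotes its characteristic exponent in the sense $\mathbb{E}[e^{bY_t}]=e^{t\phi(b)}$; $\beta$ is fixed. $\mathcal{M}(\mathbb{R}^+)$ denotes the set of probability distributions $Q$ of a random variable $N$, independent of $X$, with $Q(N\ge0)=1$ and $Q(N>s)>0$ for all $s\in[0,\infty)$; $\mathbb{E}^Q[N]$ is the mean of $N$ under $Q$. Throughout, the expectations and variances of all estimators are assumed to be finite and well-defined.
   Formalization: For λ > 2/|φ₁(β)| the stated q* has total mass √(2/(λ|φ₁(β)|)) < 1 and is not a probability density; there Q* is shown to have density q* plus the missing mass as an atom at N = 0; for λ ≤ 2/|φ₁(β)| the claim is as stated. *)

(* Defs.v *)
From HB Require Import structures.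
From mathcomp Require Import all_boot all_order all_algebra.
From mathcomp Require Import all_classical all_reals all_analysis.

Set Implicit Arguments.
Unset Strict Implicit.
Unset Printing Implicit Defensive.

Import Order.TTheory GRing.Theory Num.Theory.
Import numFieldNormedType.Exports.

Local Open Scope classical_set_scope.
Local Open Scope ring_scope.

Section product_probability.
Context d1 d2 (T1 : measurableType d1) (T2 : measurableType d2) (R : realType).
Variables (P : probability T1 R) (Q : probability T2 R).

Definition indep_prod : set (T1 * T2) -> \bar R := (P \x Q)%E.

HB.instance Definition _ := Measure.on indep_prod.

Let indep_prod_setT : indep_prod setT = 1%E.
Proof.
rewrite -setXTT [LHS]product_measure1E//.
by rewrite -[RHS]mule1; congr (_ * _)%E; exact: probability_setT.
Qed.

HB.instance Definition _ :=
  Measure_isProbability.Build _ _ _ indep_prod indep_prod_setT.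

End product_probability.

Section levy_process.
Context d (T : measurableType d) (R : realType) (P : probability T R).

Definition cadlag (f : R -> R) :=
  (forall t, 0 <= t -> f u @[u --> t^'+] --> f t) /\
  (forall t, 0 < t -> cvg (f u @[u --> t^'-])).

(* The time axis is [0, +oo[; the values [Y t] for [t < 0] play no role. *)
Record levy_process (Y : R -> {RV P >-> R}) : Prop := {
  levy_start : {ae P, forall w, Y 0 w = 0} ;
  levy_cadlag : {ae P, forall w, cadlag (fun t => Y t w)} ;
  levy_stationary : forall (s t : R) (B : set R), 0 <= s -> s <= t ->
    measurable B -> P ((Y t \- Y s) @^-1` B) = P (Y (t - s) @^-1` B) ;
  (* Taking some [B i] to be [setT] gives the product rule for subfamilies. *)
  levy_independent : forall (n : nat) (t : nat -> R) (B : nat -> set R),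
    0 <= t 0%N -> (forall i, (i < n)%N -> t i <= t i.+1) ->
    (forall i, measurable (B i)) ->
    P (\bigcap_(i < n) ((Y (t i.+1) \- Y (t i)) @^-1` B i)) =
    (\prod_(i < n) P ((Y (t i.+1) \- Y (t i))%R @^-1` B i))%E }.

(* [phi b] is [+oo] exactly when the exponential moment of order [b] is
   infinite (for one, equivalently all, [t > 0]); with [0 * +oo = 0] the
   identity also holds at [t = 0]. *)
Definition characteristic_exponent (Y : R -> {RV P >-> R}) (phi : R -> \bar R) :=
  forall b t, 0 <= t ->
    ('E_P[fun w => expR (b * Y t w)] = expeR (t%:E * phi b))%E.

End levy_process.

Section randomization.
Context d (T : measurableType d) (R : realType) (P : probability T R).

Definition admissible : set (probability (measurableTypeR R) R) :=
  [set Q : probability (measurableTypeR R) R |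
    Q `[0, +oo[%classic = 1%E /\
    forall s : R, 0 <= s -> (0 < Q `]s, +oo[%classic)%E].

(* On the product space, N is the second coordinate: it has law Q and is
   independent of the integrand G, which depends on the first one only. *)
Definition randomized_integral (G : R -> T -> R)
    (Q : probability (measurableTypeR R) R) (w : T * measurableTypeR R) : R :=
  \int[lebesgue_measure]_(s in `[0, +oo[)
    (G s w.1 * ((s < w.2)%R%:R / fine (Q `]s, +oo[%classic))).

(* Extended-real valued: a distribution giving an infinite variance or an
   infinite mean has value [+oo]. *)
Definition objective (G : R -> T -> R) (lam : R)
    (Q : probability (measurableTypeR R) R) : \bar R :=
  (variance (indep_prod P Q) (randomized_integral G Q) +
   lam%:E * 'E_Q[idfun])%E.

Definition optimal (G : R -> T -> R) (lam : R)
    (Q : probability (measurableTypeR R) R) :=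
  admissible Q /\
  objective G lam Q = ereal_inf [set objective G lam Q' | Q' in admissible].

End randomization.

Section laws.
Context (R : realType).
Local Notation mu := (@lebesgue_measure R).

Definition has_pdf (Q : probability (measurableTypeR R) R) (q : R -> R) :=
  forall A : set (measurableTypeR R), measurable A ->
    Q A = (\int[mu]_(x in A) (q x)%:E)%E.

(* The law with density q and, when the total mass of q is less than 1, the
   missing mass placed at the point 0. *)
Definition has_pdf_atom0 (Q : probability (measurableTypeR R) R) (q : R -> R) :=
  forall A : set (measurableTypeR R), measurable A ->
    Q A = ((1 - \int[mu]_x (q x)%:E) * \d_(0%R : measurableTypeR R) A +
           \int[mu]_(x in A) (q x)%:E)%E.

(* The law of [shift + E] with [E] exponential of parameter [rate]. *)
Definition shifted_exponential (Q : probability (measurableTypeR R) R)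
    (rate shift : R) :=
  forall A : set (measurableTypeR R), measurable A ->
    Q A = exponential_prob rate [set x : R | A (shift + x)].

End laws.

(* Main.v *)
(* Write F(s) = Q(N > s), a1 = |phi_1(beta)|, a2 = |phi_2(2 beta)|.  Independence
   and stationarity of the increments give E[G_s] = exp(- a1 s) and
   E[G_s G_t] = exp(- a2 s - a1 (t - s)) for s <= t, so by Tonelli the estimator
   has mean 1 / a1 and second moment (2 / a1) int_0^oo exp(- a2 s) / F(s) ds,
   while E[N] = int_0^oo F(s) ds.  Hence, up to the constant 1 / a1^2, the
   objective is int_0^oo ((2 / a1) exp(- a2 s) / F(s) + lam F(s)) ds.  For each s
   the integrand is minimized over F(s) in (0, 1] exactly at
   F*(s) = min(1, sqrt(2 / (lam a1)) exp(- a2 s / 2)), which happens to be a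
   survival function: that of max(0, sigma + e) with e exponential of parameter
   a2 / 2 and sigma = - log(lam a1 / 2) / a2.  An optimal F equals F* almost
   everywhere, hence everywhere by right-continuity. *)
Require Import Defs.
From HB Require Import structures.
From mathcomp Require Import all_boot all_order all_algebra.
From mathcomp Require Import all_classical all_reals all_analysis.
From mathcomp Require Import measurable_realfun ring lra.
Import Order.TTheory GRing.Theory Num.Theory.
Import numFieldNormedType.Exports.

Set Implicit Arguments.
Unset Strict Implicit.
Unset Printing Implicit Defensive.

Local Open Scope classical_set_scope.
Local Open Scope ring_scope.

(** * Integrals off null sets, laws determined by rays, independent products *)

Section integral_eq_off_null.
Import HBNNSimple.
(* [f] and [g] need not be measurable: the estimator is only known to agree with
   a measurable function off a null set. *)
Lemma ge0_integral_eq_off_null d (T : measurableType d) (R : realType)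
    (mu : {measure set T -> \bar R}) (N : set T) (f g : T -> \bar R) :
  measurable N -> mu N = 0%E ->
  (forall x, (0 <= f x)%E) -> (forall x, (0 <= g x)%E) ->
  (forall x, ~ N x -> f x = g x) ->
  (\int[mu]_x f x = \int[mu]_x g x)%E.
Proof.
move=> mN N0; wlog suff H : f g / (forall x, (0 <= f x)%E) ->
    (forall x, (0 <= g x)%E) -> (forall x, ~ N x -> f x = g x) ->
    (\int[mu]_x f x <= \int[mu]_x g x)%E.
  move=> f0 g0 fg; apply/eqP; rewrite eq_le !H// => x Nx.
  by rewrite fg.
move=> f0 g0 fg; rewrite ge0_integralTE// ge0_integralTE//.
apply: ge_ereal_sup => _ /= [h hf <-].
(* Zeroing [h] on [N] leaves its integral unchanged and puts it below [g] everywhere: [f] and [g]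
   agree off [N], and [g] is nonnegative on it. *)
pose h' := proj_nnsfun h (measurableC mN).
have h'E x : h' x = h x * \1_(~` N) x by [].
rewrite (_ : sintegral mu h = sintegral mu h').
  apply: ereal_sup_ubound; exists h' => // x.
  rewrite h'E indicE; case: (boolP (x \in ~` N)) => [|_]; last by rewrite mulr0.
  by rewrite inE => Nx; rewrite mulr1 -fg.
rewrite -!integralT_nnsfun.
apply: ge0_ae_eq_integral => //.
- by apply/measurable_EFinP.
- by apply/measurable_EFinP.
- by move=> x _; rewrite lee_fin.
- by move=> x _; rewrite lee_fin.
exists N; split => // x /= /not_implyP[_]; apply: contra_notP => Nx.
by congr (_%:E); rewrite [RHS]h'E indicE mem_set// mulr1.
Qed.

End integral_eq_off_null.

(** Open rays are stable under intersection and generate the Borel sets, and the rays ]-k, +oo[, of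
    finite measure, exhaust the line; uniqueness of measures applies. *)
Lemma measure_eq_rays (R : realType)
    (m1 m2 : {measure set (measurableTypeR R) -> \bar R}) :
  (forall s : R, m1 `]s, +oo[%classic = m2 `]s, +oo[%classic) ->
  (forall s : R, (m1 `]s, +oo[%classic < +oo)%E) ->
  forall A, measurable A -> m1 A = m2 A.
Proof.
move=> m12 m1oo A mA.
apply: (@measure_unique _ R (measurableTypeR R) (@RGenOInfty.G R)
  (fun k => `](- k%:R : R), +oo[%classic)) => //.
- exact: RGenOInfty.measurableE.
- move=> _ _ [x ->] [y ->]; exists (Num.max x y).
  by apply/seteqP; split => z /=; rewrite !in_itv/= !andbT gt_max => /andP.
- by move=> i; exists (- i%:R).
- rewrite -subTset => x _; exists (Num.truncn `|x|).+1 => //=.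
  rewrite in_itv/= andbT ltrNl (le_lt_trans _ (truncnS_gt `|x|))//.
  by rewrite -normrN ler_norm.
- by move=> _ [x ->].
Qed.

(** The product rule on rectangles identifies the law of [(A, B)] with the product of the marginal
    laws; Tonelli then separates the factors. *)
Lemma ge0_integral_indep_mul d (T : measurableType d) (R : realType)
    (P : probability T R) (A B : {RV P >-> R}) (f g : R -> \bar R) :
  (forall U V, measurable U -> measurable V ->
    P (A @^-1` U `&` B @^-1` V) = (P (A @^-1` U) * P (B @^-1` V))%E) ->
  measurable_fun setT f -> measurable_fun setT g ->
  (forall x, (0 <= f x)%E) -> (forall x, (0 <= g x)%E) ->
  (\int[P]_w (f (A w) * g (B w)) =
   (\int[P]_w f (A w)) * (\int[P]_w g (B w)))%E.
Proof.
move=> AB mf mg f0 g0.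
pose AB' : T -> (R * R)%type := fun w => (A w, B w).
have mAB : measurable_fun setT AB' by exact: measurable_fun_pair.
pose h (z : R * R) := (f z.1 * g z.2)%E.
have mh : measurable_fun setT h.
  by apply: emeasurable_funM; apply: measurableT_comp.
have h0 z : (0 <= h z)%E by rewrite mule_ge0.
transitivity (\int[pushforward P AB']_z h z)%E.
  by rewrite ge0_integral_pushforward.
transitivity (\int[distribution P A \x distribution P B]_z h z)%E.
  apply: eq_measure_integral => //= D mD _; apply/esym.
  apply: product_measure_unique => //= U V mU mV; exact: AB.
rewrite fubini_tonelli1// /fubini_F /h/=.
under eq_integral do rewrite ge0_integralZl//.
rewrite ge0_integralZr//; last exact: integral_ge0.
by rewrite !ge0_integral_distribution.
Qed.

(** * Joint measurability of right-continuous processes *)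

(** The grid time depends on the time only through an integer [k]. On each strip where [k] is fixed
    the map is a single random variable, and countably many strips cover the product. *)
Lemma measurable_fun_step_process d (T : measurableType d) (R : realType)
    (Z : R -> T -> R) (n : nat) :
  (forall t, measurable_fun setT (Z t)) ->
  measurable_fun setT (fun z : (R * T)%type =>
    Z ((Num.truncn (z.1 * n.+1%:R)).+1%:R / n.+1%:R) z.2).
Proof.
move=> mZ.
pose E k : set (R * T) := [set s | Num.truncn (s * n.+1%:R) = k] `*` setT.
have mE k : measurable (E k).
  apply: measurableX => //.
  have m : measurable_fun setT (fun s : R => (Num.truncn (s * n.+1%:R))%:R : R).
    apply: nondecreasing_measurable => // x y xy; rewrite ler_nat.
    by apply: Num.Theory.le_truncn; rewrite ler_wpM2r.
  rewrite (_ : mkset _ = (fun s : R => (Num.truncn (s * n.+1%:R))%:R : R)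
     @^-1` [set k%:R]).
    by rewrite -[X in measurable X]setTI; exact: m.
  apply/seteqP; split => s /= [].
    by move=> ->.
  by move/eqP; rewrite eqr_nat => /eqP.
rewrite (_ : setT = \bigcup_k E k); last first.
  apply/seteqP; split => // -[s w] _.
  by exists (Num.truncn (s * n.+1%:R)).
apply/measurable_fun_bigcup => // k.
apply: (eq_measurable_fun (fun z => Z (k.+1%:R / n.+1%:R) z.2)).
  by move=> -[s w]; rewrite inE /E /= => -[-> _].
by apply: measurable_funTS; exact: measurableT_comp.
Qed.

(** The next grid point lies within 1/(n+1) of [s] and strictly to its right, as a limit along
    [s^'+] requires. *)
Lemma step_cvg_right (R : realType) (s : R) : 0 <= s ->
  (forall n, s < (Num.truncn (s * n.+1%:R)).+1%:R / n.+1%:R) /\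
  (Num.truncn (s * n.+1%:R)).+1%:R / n.+1%:R @[n --> \oo] --> s.
Proof.
move=> s0; have H n : s < (Num.truncn (s * n.+1%:R)).+1%:R / n.+1%:R.
  by rewrite ltr_pdivlMr ?ltr0n// Num.Theory.truncnS_gt.
split=> //.
apply: (@squeeze_cvgr _ _ _ _ (fun _ => s) (fun n => s + n.+1%:R^-1)).
- apply: nearW => n; rewrite (ltW (H n))/= ler_pdivrMr ?ltr0n//.
  rewrite mulrDl mulVf ?pnatr_eq0// -natr1 lerD2r.
  by rewrite Num.Theory.truncn_le// mulr_ge0.
- exact: cvg_cst.
- rewrite -[X in _ --> X]addr0; apply: cvgD; first exact: cvg_cst.
  exact: cvg_harmonic.
Qed.

(* Joint measurability holds only for a modification of the process, obtained
   as a limit of step processes on the event of right-continuous paths. *)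
Lemma right_continuous_jointly_measurable d (T : measurableType d)
    (R : realType) (Z : R -> T -> R) (N : set T) :
  measurable N ->
  (forall t, measurable_fun setT (Z t)) ->
  (forall w, ~ N w -> forall t, 0 <= t -> Z u w @[u --> t^'+] --> Z t w) ->
  exists2 H : R * T -> R, measurable_fun setT H &
    forall s w, 0 <= s -> ~ N w -> H (s, w) = Z s w.
Proof.
move=> mN mZ cZ.
(* Off [D] the approximations and the limit are all 0, so convergence holds at every point. *)
pose D : set (R * T) := `[0, +oo[%classic `*` ~` N.
have mD : measurable D by apply: measurableX => //; exact: measurableC.
pose H (z : R * T) := \1_D z * Z z.1 z.2.
exists H; last first.
  move=> s w s0 Nw; rewrite /H indicE mem_set ?mul1r//.
  by split => //=; rewrite in_itv/= s0.
pose h n (z : R * T) :=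
  \1_D z * Z ((Num.truncn (z.1 * n.+1%:R)).+1%:R / n.+1%:R) z.2.
apply: (measurable_fun_cvg (h := h)).
  move=> n; apply: measurable_funM; last exact: measurable_fun_step_process.
  exact: measurable_indic.
move=> -[s w] _; rewrite /h /H /=.
rewrite indicE; case: (boolP ((s, w) \in D)) => [|_]; last first.
  by rewrite mul0r; under eq_fun do rewrite mul0r; exact: cvg_cst.
rewrite inE => -[/=]; rewrite in_itv/= andbT => s0 Nw.
rewrite mul1r; under eq_fun do rewrite mul1r.
by have /cvg_at_rightP/(_ _ (step_cvg_right s0)) := cZ w Nw s s0.
Qed.

(** * Exponential moments of a Lévy process *)

Lemma expectation_expR d (T : measurableType d) (R : realType)
    (P : probability T R) (X : T -> R) :
  ('E_P[fun w => expR (X w)] = \int[P]_w (expR (X w))%:E)%E.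
Proof. by rewrite unlock. Qed.

(** The value -oo would give the strictly positive variable [expR (b * Y 1 w)] mean zero, hence make
    it vanish almost surely. *)
Lemma characteristic_exponent_fin_num d (T : measurableType d) (R : realType)
    (P : probability T R) (Y : R -> {RV P >-> R}) (phi : R -> \bar R) b :
  characteristic_exponent Y phi -> (phi b < +oo)%E -> phi b \is a fin_num.
Proof.
move=> phiY phi_oo; rewrite fin_numE (lt_eqF phi_oo) andbT; apply/eqP => phib.
have := phiY b 1 ler01; rewrite expectation_expR mul1e phib /=.
have m : measurable_fun setT (fun w => (expR (b * Y 1 w))%:E).
  apply/measurable_EFinP/measurableT_comp => //.
  exact: measurable_funM.
under eq_integral do rewrite -[X in X%:E]ger0_norm ?expR_ge0//.
move=> /(ae_eq_integral_abs P measurableT m).1 [N [mN PN0 subN]].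
have : P setT = 0%E.
  apply: (subset_measure0 _ mN) => // w _; apply: subN => /=.
  by move=> /(_ I) [] /eqP; rewrite gt_eqF// expR_gt0.
by rewrite probability_setT => /eqP; rewrite onee_eq0.
Qed.

Section levy_moments.
Context d (T : measurableType d) (R : realType) (P : probability T R).
Variables (Y : R -> {RV P >-> R}) (phi : R -> \bar R).
Hypothesis levyY : levy_process Y.
Hypothesis phiY : characteristic_exponent Y phi.

Lemma levy_exp_moment (b r t : R) : 0 <= t -> phi b = r%:E ->
  (\int[P]_w (expR (b * Y t w))%:E = (expR (t * r))%:E)%E.
Proof.
by move=> t0 br; rewrite -expectation_expR phiY// br -EFinM.
Qed.

Lemma levy_increment_exp_moment (b r s t : R) : 0 <= s -> s <= t ->
  phi b = r%:E ->
  (\int[P]_w (expR (b * (Y t w - Y s w)))%:E = (expR ((t - s) * r))%:E)%E.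
Proof.
move=> s0 st br; rewrite -(levy_exp_moment (b := b))//; last by rewrite subr_ge0.
pose f (x : R) := (expR (b * x))%:E.
have mf : measurable_fun setT f.
  by apply/measurable_EFinP/measurableT_comp => //; exact: measurable_funM.
have f0 x : (0 <= f x)%E by rewrite lee_fin expR_ge0.
pose D : {RV P >-> R} := (Y t \- Y s)%R.
transitivity (\int[distribution P D]_x f x)%E.
  by rewrite ge0_integral_distribution.
transitivity (\int[distribution P (Y (t - s))]_x f x)%E; last first.
  by rewrite ge0_integral_distribution.
apply: eq_measure_integral => /= A mA _.
exact: (levy_stationary levyY).
Qed.

Lemma levy_increment_indep (s t : R) (U V : set R) : 0 <= s -> s <= t ->
  measurable U -> measurable V ->
  P ((Y s \- Y 0) @^-1` U `&` (Y t \- Y s) @^-1` V) =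
  (P ((Y s \- Y 0)%R @^-1` U) * P ((Y t \- Y s)%R @^-1` V))%E.
Proof.
move=> s0 st mU mV.
(* Two increments over the times 0, s, t; the default [setT] keeps every event of the sequence
   measurable. *)
have := levy_independent levyY (n := 2%N) (t := fun i => nth 0 [:: 0; s; t] i)
  (B := fun i => nth setT [:: U; V] i).
rewrite bigcap_mkord !big_ord_recl !big_ord0 /= setIT mule1; apply => //.
- by case => [|[|]].
- by case => [|[|i]]//=; rewrite nth_nil.
Qed.

(** Since [Y 0] vanishes almost surely, b (Y_s + Y_t) = 2b (Y_s - Y_0) + b (Y_t - Y_s), a
    combination of independent increments. *)
Lemma levy_mixed_moment (b r1 r2 s t : R) : 0 <= s -> s <= t ->
  phi b = r1%:E -> phi (2 * b) = r2%:E ->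
  (\int[P]_w (expR (b * Y s w) * expR (b * Y t w))%:E =
   (expR (s * r2 + (t - s) * r1))%:E)%E.
Proof.
move=> s0 st br1 br2.
have mexp c (X : {RV P >-> R}) : measurable_fun setT (fun w => expR (c * X w)).
  by apply: measurableT_comp => //; exact: measurable_funM.
pose f c (x : R) := (expR (c * x))%:E.
have mf c : measurable_fun setT (f c).
  by apply/measurable_EFinP/measurableT_comp => //; exact: measurable_funM.
have f0 c x : (0 <= f c x)%E by rewrite lee_fin expR_ge0.
pose A : {RV P >-> R} := (Y s \- Y 0)%R.
pose B : {RV P >-> R} := (Y t \- Y s)%R.
have Y0 := levy_start levyY.
transitivity (\int[P]_w (f (2 * b)%R (A w) * f b (B w)))%E.
  apply: ge0_ae_eq_integral => //.
  - by apply/measurable_EFinP; exact: measurable_funM.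
  - by apply: emeasurable_funM; apply: measurableT_comp.
  - by move=> w _; rewrite lee_fin mulr_ge0// expR_ge0.
  move: Y0; apply: filterS => w /= Y0w _.
  rewrite /f -EFinM -!expRD Y0w subr0; congr (expR _)%:E.
  by rewrite /B/=; ring.
rewrite ge0_integral_indep_mul//; last first.
  by move=> U V mU mV; exact: levy_increment_indep.
rewrite expRD EFinM; congr (_ * _)%E.
- rewrite -(levy_exp_moment (b := 2 * b))//.
  apply: ge0_ae_eq_integral => //.
  - exact: measurableT_comp.
  - by apply/measurable_EFinP.
  move: Y0; apply: filterS => w /= Y0w _.
  by rewrite /f Y0w subr0.
- exact: levy_increment_exp_moment.
Qed.

End levy_moments.

(** * Tail integrals of the exponential density *)

Section exponential_tail.
Context (R : realType) (a : R).
Hypothesis a0 : 0 < a.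
Local Notation mu := (@lebesgue_measure R).

(** The tail is what the mass of [0, s] leaves of the total mass 1. Both kinds of endpoint are
    treated because a double integral is later split along the diagonal into a closed and an open
    half. *)
Lemma exponential_tail b (s : R) : 0 <= s ->
  (\int[mu]_(x in [set` Interval (BSide b s) +oo%O]) (exponential_pdf a x)%:E =
   (expR (- (a * s)))%:E)%E.
Proof.
have mpdf D : measurable_fun D (fun x => (exponential_pdf a x)%:E).
  by apply/measurable_EFinP/measurable_funTS; exact: measurable_exponential_pdf.
have pdf0 x : (0 <= (exponential_pdf a x)%:E)%E.
  by rewrite lee_fin exponential_pdf_ge0// ltW.
have H0 : (\int[mu]_(x in `[0%R, +oo[) (exponential_pdf a x)%:E = 1)%E.
  rewrite -(integral_exponential_pdf a0) [LHS]integral_mkcond.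
  apply: eq_integral => x _; rewrite patchE; case: ifPn => //.
  rewrite notin_setE /= in_itv/= andbT => /negP; rewrite -ltNge => x0.
  by rewrite lt0_exponential_pdf.
rewrite le_eqVlt => /predU1P[<-|s0].
  by rewrite mulr0 oppr0 expR0 -H0; case: b => //; rewrite integral_itv_obnd_cbnd.
have -> : (\int[mu]_(x in [set` Interval (BSide b s) +oo%O])
      (exponential_pdf a x)%:E =
    \int[mu]_(x in `]s, +oo[) (exponential_pdf a x)%:E)%E.
  by case: b => //; rewrite -integral_itv_obnd_cbnd.
have := exponential_prob_itv0c a s0; rewrite /exponential_prob mulNr => Hs.
move: H0; rewrite (@itv_bndbnd_setU _ _ _ (BRight s))//; last first.
  by rewrite bnd_simp ltW.
rewrite ge0_integral_setU//=; last first.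
  apply/disj_setPS => y [/=]; rewrite 2!in_itv/= => /andP[_ ys].
  by rewrite ltNge ys.
  exact: mpdf.
rewrite Hs; case: (\int[mu]_(x in _) _)%E => [x| |] //= [] H.
by congr (_%:E); lra.
Qed.

(** On the ray the integrand is a^-1 e^(a s) times the exponential density of rate [a]. *)
Lemma exponential_shifted_tail b (s : R) : 0 <= s ->
  (\int[mu]_t (\1_[set` Interval (BSide b s) +oo%O] t *
     expR (- (a * (t - s))))%:E = (a^-1)%:E)%E.
Proof.
move=> s0.
transitivity (\int[mu]_(t in [set` Interval (BSide b s) +oo%O])
  ((a^-1 * expR (a * s))%:E * (exponential_pdf a t)%:E))%E.
  rewrite [RHS]integral_mkcond; apply: eq_integral => t _.
  rewrite patchE indicE; case: ifPn => [|_]; last by rewrite mul0r.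
  rewrite inE /= => st; have t0 : 0 <= t.
    by apply: (le_trans s0); move: st; case: b; rewrite in_itv/= andbT => // /ltW.
  rewrite mul1r -EFinM exponential_pdfE//; congr (_%:E).
  rewrite (_ : - (a * (t - s)) = a * s + - a * t); last by ring.
  by rewrite expRD; field; rewrite gt_eqF.
rewrite ge0_integralZl//=.
- rewrite exponential_tail// -EFinM -mulrA -expRD subrr expR0 mulr1//.
- by apply/measurable_EFinP/measurable_funTS; exact: measurable_exponential_pdf.
- by move=> x _; rewrite lee_fin exponential_pdf_ge0// ltW.
- by rewrite lee_fin mulr_ge0 ?invr_ge0 ?expR_ge0// ltW.
Qed.

End exponential_tail.

(** * First two moments of the estimator for a fixed law of N *)

Section randomized_moments.
Context d (T : measurableType d) (R : realType) (P : probability T R).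
Variable Q : probability (measurableTypeR R) R.
Variables (H : R * T -> R) (a1 a2 : R).
Local Notation mu := (@lebesgue_measure R).
Local Notation nu := (indep_prod P Q).
Local Notation F := (fun s : R => fine (Q `]s, +oo[%classic)).

Lemma survivalE (s : R) : (F s)%:E = Q `]s, +oo[%classic.
Proof. by rewrite fineK// fin_num_measure. Qed.

Lemma survival_nonincreasing : {homo F : s t / s <= t >-> t <= s}.
Proof.
move=> s t st; rewrite fine_le ?fin_num_measure// le_measure ?inE//.
exact: subitvPl.
Qed.

Lemma measurable_survival : measurable_fun setT F.
Proof.
by apply: nonincreasing_measurable => //; exact: survival_nonincreasing.
Qed.

Lemma integral_indep_prod (f : T * measurableTypeR R -> \bar R) :
  (\int[nu]_z f z = \int[P \x Q]_z f z)%E.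
Proof. exact: eq_measure_integral. Qed.

Lemma ge0_integral_indep_prod_mul (u : T -> R) (v : R -> R) :
  measurable_fun setT u -> measurable_fun setT v ->
  (forall w, 0 <= u w) -> (forall n, 0 <= v n) ->
  (\int[nu]_z (u z.1 * v z.2)%:E =
   (\int[P]_w (u w)%:E) * (\int[Q]_n (v n)%:E))%E.
Proof.
move=> mu_ mv u0 v0; rewrite integral_indep_prod fubini_tonelli1; last 2 first.
- apply/measurable_EFinP; apply: measurable_funM.
    exact: measurableT_comp.
  exact: (measurableT_comp mv).
- by move=> z; rewrite lee_fin mulr_ge0.
rewrite /fubini_F/=.
under eq_integral => w _.
  under eq_integral do rewrite EFinM.
  rewrite ge0_integralZl//; last first.
  - by rewrite lee_fin.
  - by move=> n _; rewrite lee_fin.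
  - by apply/measurable_EFinP.
  over.
rewrite ge0_integralZr//.
- by apply/measurable_EFinP.
- by move=> w _; rewrite lee_fin.
- by apply: integral_ge0 => n _; rewrite lee_fin.
Qed.

Lemma integral_survival (s : R) : (\int[Q]_n ((s < n)%R%:R)%:E = (F s)%:E)%E.
Proof.
rewrite survivalE.
transitivity (\int[Q]_n (\1_(`]s, +oo[%classic : set R) n)%:E)%E.
  apply: eq_integral => n _; rewrite indicE; congr ((nat_of_bool _)%:R%:E).
  by apply/idP/idP; rewrite inE/= in_itv/= andbT.
by rewrite integral_indic// setIT.
Qed.

(* [H] stands for a jointly measurable modification of the integrand. *)
Definition sampled (s : R) (z : T * measurableTypeR R) : R :=
  \1_(`[0, +oo[%classic : set R) s * (H (s, z.1) * ((s < z.2)%R%:R / F s)).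

Hypothesis mH : measurable_fun setT H.
Hypothesis H0 : forall z, 0 <= H z.
Hypothesis F0 : forall s, 0 <= s -> 0 < F s.

Lemma sampled_ge0 s z : 0 <= sampled s z.
Proof.
by rewrite /sampled indicE !mulr_ge0 ?invr_ge0 ?fine_ge0 ?measure_ge0 ?ler0n.
Qed.

(** For negative [s], monotonicity gives F(s) >= F(0). Positivity on the whole line makes 1/F
    monotone, hence measurable. *)
Lemma survival_gt0 s : 0 < F s.
Proof.
have [/F0//|s0] := leP 0 s; apply: (lt_le_trans (F0 (lexx 0))).
exact/survival_nonincreasing/ltW.
Qed.

Lemma measurable_survivalV : measurable_fun setT (fun s => (F s)^-1).
Proof.
apply: nondecreasing_measurable => // s t st.
by rewrite lef_pV2 ?posrE ?survival_gt0//; exact: survival_nonincreasing.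
Qed.

Lemma measurable_ltr_indic d' (T' : measurableType d') (f g : T' -> R) :
  measurable_fun setT f -> measurable_fun setT g ->
  measurable_fun setT (fun x => (f x < g x)%R%:R : R).
Proof.
move=> mf mg.
rewrite (_ : (fun _ => _) = fun x => if f x < g x then 1 else 0); last first.
  by apply/funext => x; case: ifP.
by apply: measurable_fun_ifT => //; exact: measurable_fun_ltr.
Qed.

Lemma measurable_sampled :
  measurable_fun setT (fun x : R * (T * measurableTypeR R) => sampled x.1 x.2).
Proof.
apply: measurable_funM.
  have m0 : measurable_fun setT (\1_(`[0, +oo[%classic : set R) : R -> R).
    exact: measurable_indic.
  exact: (measurableT_comp m0).
apply: measurable_funM.
  apply: (measurableT_comp mH); apply: measurable_fun_pair => //.
  exact: (measurableT_comp measurable_fst measurable_snd).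
apply: measurable_funM; last exact: (measurableT_comp measurable_survivalV).
apply: measurable_ltr_indic => //.
exact: (measurableT_comp measurable_snd measurable_snd).
Qed.

Lemma measurable_sampledr s : measurable_fun setT (sampled s).
Proof. exact: (measurableT_comp measurable_sampled (pair1_measurable s)). Qed.

Definition sampled_integral z := (\int[mu]_s (sampled s z)%:E)%E.

Lemma sampled_integral_ge0 z : (0 <= sampled_integral z)%E.
Proof. by apply: integral_ge0 => s _; rewrite lee_fin sampled_ge0. Qed.

Lemma measurable_sampled_integral : measurable_fun setT sampled_integral.
Proof.
apply: (measurable_fun_fubini_tonelli_G (m1 := mu)
  (fun x : R * (T * measurableTypeR R) => (sampled x.1 x.2)%:E)).
  by apply/measurable_EFinP; exact: measurable_sampled.
by move=> x; rewrite lee_fin sampled_ge0.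
Qed.

Hypothesis m1 : forall s, 0 <= s ->
  (\int[P]_w (H (s, w))%:E = (expR (- (a1 * s)))%:E)%E.
Hypothesis m2 : forall s t, 0 <= s -> s <= t ->
  (\int[P]_w (H (s, w) * H (t, w))%:E =
    (expR (- (a2 * s) - a1 * (t - s)))%:E)%E.
Hypothesis a10 : 0 < a1.

Lemma sampled_lt0 s z : s < 0 -> sampled s z = 0.
Proof.
move=> s0; rewrite /sampled indicE memNset ?mul0r//= in_itv/= andbT.
by apply/negP; rewrite -ltNge.
Qed.

Lemma sampled_ge0E s z : 0 <= s ->
  sampled s z = H (s, z.1) * ((s < z.2)%R%:R / F s).
Proof.
by move=> s0; rewrite /sampled indicE mem_set ?mul1r//= in_itv/= andbT.
Qed.

(** The indicator of N > s has mean F(s), which cancels the weight 1/F(s): the sampling introduces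
    no bias. *)
Lemma sampled_mean s :
  (\int[nu]_z (sampled s z)%:E =
    (\1_(`[0, +oo[%classic : set R) s * expR (- (a1 * s)))%:E)%E.
Proof.
have [s0|s0] := ltP s 0.
  rewrite integral0_eq => [|z _]; last by rewrite sampled_lt0.
  by rewrite indicE memNset ?mul0r//= in_itv/= andbT; apply/negP; rewrite -ltNge.
rewrite indicE mem_set ?mul1r//=; last by rewrite in_itv/= andbT.
under eq_integral do rewrite sampled_ge0E//.
rewrite (ge0_integral_indep_prod_mul (u := fun w => H (s, w))
  (v := fun n => (s < n)%R%:R / F s)).
- rewrite m1//.
  under eq_integral do rewrite EFinM muleC.
  rewrite ge0_integralZl//.
  + by rewrite integral_survival -EFinM mulVf ?mulr1// gt_eqF// survival_gt0.
  + by apply/measurable_EFinP; exact: measurable_ltr_indic.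
  + by rewrite lee_fin invr_ge0 fine_ge0.
- exact: (measurableT_comp mH).
- by apply: measurable_funM => //; exact: measurable_ltr_indic.
- by [].
- by move=> n; rewrite mulr_ge0// invr_ge0 fine_ge0.
Qed.

(** For s <= t the product of the two indicators is that of N > t. Its mean cancels the weight at
    [t]; the weight at the earlier time survives. *)
Lemma sampled_cross s t : 0 <= s -> s <= t ->
  (\int[nu]_z (sampled s z * sampled t z)%:E =
    (expR (- (a2 * s) - a1 * (t - s)) / F s)%:E)%E.
Proof.
move=> s0 st; have t0 := le_trans s0 st.
transitivity (\int[nu]_z
   (H (s, z.1) * H (t, z.1) * ((t < z.2)%R%:R * ((F s)^-1 / F t)))%:E)%E.
  apply: eq_integral => z _; rewrite !sampled_ge0E//; congr (_%:E).
  have [tz|tz] := ltP t z.2.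
    by rewrite (le_lt_trans st tz)/=; ring.
  by rewrite /= !(mul0r, mulr0).
rewrite (ge0_integral_indep_prod_mul (u := fun w => H (s, w) * H (t, w))
  (v := fun n => (t < n)%R%:R * ((F s)^-1 / F t))).
- rewrite m2// EFinM; congr (_ * _)%E.
  under eq_integral do rewrite EFinM muleC.
  rewrite ge0_integralZl//.
  + by rewrite integral_survival -EFinM divfK// gt_eqF// survival_gt0.
  + by apply/measurable_EFinP; exact: measurable_ltr_indic.
  + by rewrite lee_fin mulr_ge0// invr_ge0 fine_ge0.
- by apply: measurable_funM; exact: (measurableT_comp mH).
- by apply: measurable_funM => //; exact: measurable_ltr_indic.
- by move=> w; rewrite mulr_ge0.
- by move=> n; rewrite !mulr_ge0// invr_ge0 fine_ge0.
Qed.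

Lemma sampled_integral_mean :
  (\int[nu]_z sampled_integral z = (a1^-1)%:E)%E.
Proof.
rewrite /sampled_integral -(fubini_tonelli (m1 := mu) (m2 := nu)
  (fun x : R * (T * measurableTypeR R) => (sampled x.1 x.2)%:E))/=.
- under eq_integral do rewrite sampled_mean.
  rewrite -(exponential_shifted_tail a10 true (lexx 0)).
  by apply: eq_integral => s _; rewrite subr0.
- by apply/measurable_EFinP; exact: measurable_sampled.
- by move=> x; rewrite lee_fin sampled_ge0.
Qed.

Let cross s t := (\int[nu]_z (sampled s z * sampled t z)%:E)%E.

Let cross_ge0 s t : (0 <= cross s t)%E.
Proof. by apply: integral_ge0 => z _; rewrite lee_fin mulr_ge0// sampled_ge0. Qed.

Let crossC s t : cross s t = cross t s.
Proof. by apply: eq_integral => z _; rewrite mulrC. Qed.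

Let measurable_cross : measurable_fun setT (fun x : R * R => cross x.1 x.2).
Proof.
apply: (measurable_fun_fubini_tonelli_F (m2 := nu)
  (fun x : (R * R) * (T * measurableTypeR R) =>
     (sampled x.1.1 x.2 * sampled x.1.2 x.2)%:E)).
  apply/measurable_EFinP; apply: measurable_funM.
    apply: (measurableT_comp measurable_sampled
      (g := fun x : (R * R) * (T * measurableTypeR R) => (x.1.1, x.2))).
    apply: measurable_fun_pair => //.
    exact: (measurableT_comp measurable_fst measurable_fst).
  apply: (measurableT_comp measurable_sampled
    (g := fun x : (R * R) * (T * measurableTypeR R) => (x.1.2, x.2))).
  apply: measurable_fun_pair => //.
  exact: (measurableT_comp measurable_snd measurable_fst).
by move=> x; rewrite lee_fin mulr_ge0// sampled_ge0.
Qed.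

(** The square is a double time integral; Tonelli moves the expectation inside once for each time
    variable. *)
Let integral_cross : (\int[nu]_z (sampled_integral z * sampled_integral z) =
  \int[mu]_s \int[mu]_t cross s t)%E.
Proof.
transitivity (\int[nu]_z \int[mu]_s ((sampled s z)%:E * sampled_integral z))%E.
  apply: eq_integral => z _; rewrite ge0_integralZr//.
  - apply/measurable_EFinP.
    exact: (measurableT_comp measurable_sampled (pair2_measurable z)).
  - by move=> s _; rewrite lee_fin sampled_ge0.
  - exact: sampled_integral_ge0.
rewrite -(fubini_tonelli (m1 := mu) (m2 := nu)
  (fun x : R * (T * measurableTypeR R) =>
     ((sampled x.1 x.2)%:E * sampled_integral x.2)%E))/=; last 2 first.
- apply: emeasurable_funM.
    by apply/measurable_EFinP; exact: measurable_sampled.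
  exact: (measurableT_comp measurable_sampled_integral).
- by move=> x; rewrite mule_ge0 ?sampled_integral_ge0// lee_fin sampled_ge0.
apply: eq_integral => s _.
transitivity (\int[nu]_z \int[mu]_t (sampled s z * sampled t z)%:E)%E.
  apply: eq_integral => z _; rewrite -ge0_integralZl//.
  - apply/measurable_EFinP.
    exact: (measurableT_comp measurable_sampled (pair2_measurable z)).
  - by move=> t _; rewrite lee_fin sampled_ge0.
  - by rewrite lee_fin sampled_ge0.
rewrite -(fubini_tonelli (m1 := mu) (m2 := nu)
  (fun x : R * (T * measurableTypeR R) =>
     (sampled s x.2 * sampled x.1 x.2)%:E))//=.
- apply/measurable_EFinP; apply: measurable_funM; last exact: measurable_sampled.
  exact: (measurableT_comp (measurable_sampledr s)).
- by move=> x; rewrite lee_fin mulr_ge0// sampled_ge0.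
Qed.

(** Over the later times [t], the factor e^(- a1 (t - s)) integrates to [a1^-1]; [b] decides whether
    the diagonal t = s is included. *)
Let half b s : (\int[mu]_t
    ((\1_([set` Interval (BSide b s) +oo%O] : set R) t)%:E * cross s t) =
  (\1_(`[0, +oo[%classic : set R) s * (a1^-1 * (expR (- (a2 * s)) / F s)))%:E)%E.
Proof.
have [s0|s0] := ltP s 0.
  rewrite integral0_eq => [|t _].
    by rewrite indicE memNset ?mul0r//= in_itv/= andbT; apply/negP; rewrite -ltNge.
  rewrite /cross integral0_eq ?mule0// => z _.
  by rewrite sampled_lt0// mul0r.
rewrite indicE mem_set ?mul1r//=; last by rewrite in_itv/= andbT.
transitivity (\int[mu]_t ((expR (- (a2 * s)) / F s)%:E *
  (\1_([set` Interval (BSide b s) +oo%O] : set R) t *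
     expR (- (a1 * (t - s))))%:E))%E.
  apply: eq_integral => t _; rewrite indicE.
  case: (boolP (t \in _)) => [|_]; last by rewrite mul0e mul0r mule0.
  rewrite inE /= => st; have {}st : s <= t.
    by move: st; case: b; rewrite in_itv/= andbT // => /ltW.
  rewrite mul1e mul1r /cross sampled_cross// -EFinM; congr (_%:E).
  by rewrite expRD; ring.
rewrite ge0_integralZl//.
- by rewrite (exponential_shifted_tail a10 b s0) -EFinM mulrC.
- apply/measurable_EFinP; apply: measurable_funM; first exact: measurable_indic.
  apply: measurableT_comp => //; apply: measurableT_comp => //.
  by apply: measurable_funM => //; exact: measurable_funB.
- by rewrite lee_fin divr_ge0 ?expR_ge0 ?fine_ge0.
Qed.

Lemma sampled_integral_second_moment :
  (\int[nu]_z (sampled_integral z * sampled_integral z) =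
   \int[mu]_(s in `[0%R, +oo[) (2 / a1 * (expR (- (a2 * s)) / F s))%:E)%E.
Proof.
rewrite integral_cross.
(* [A] carries the region s <= t and [B] the region t < s, so the diagonal is counted once. *)
pose A (s t : R) :=
  ((\1_(`[s, +oo[%classic : set R) t)%:E * cross s t)%E.
pose B (s t : R) :=
  ((\1_(`]t, +oo[%classic : set R) s)%:E * cross t s)%E.
have AE (s t : R) : A s t = ((1 - (t < s)%R%:R)%:E * cross s t)%E.
  rewrite /A indicE; congr (_%:E * _)%E.
  have [ts|st] := ltP t s; last by rewrite mem_set ?subr0//= in_itv/= st.
  by rewrite memNset ?subrr//= in_itv/= andbT; apply/negP; rewrite -ltNge.
have BE (s t : R) : B s t = ((t < s)%R%:R%:E * cross t s)%E.
  rewrite /B indicE; congr (_%:E * _)%E.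
  have [ts|st] := ltP t s; first by rewrite mem_set ?subr0//= in_itv/= ts.
  by rewrite memNset//= in_itv/= andbT; apply/negP; rewrite -leNgt.
have A0 s t : (0 <= A s t)%E by rewrite mule_ge0// lee_fin indicE ler0n.
have B0 s t : (0 <= B s t)%E by rewrite mule_ge0// lee_fin indicE ler0n.
have ms : measurable_fun setT (fun x : R * R => (x.2 < x.1)%R%:R : R).
  exact: measurable_ltr_indic.
have mA : measurable_fun setT (fun x : R * R => A x.1 x.2).
  rewrite (_ : (fun _ => _) = fun x => ((1 - (x.2 < x.1)%R%:R)%:E * cross x.1 x.2)%E).
    by apply: emeasurable_funM => //; apply/measurable_EFinP; exact: measurable_funB.
  by apply/funext => x; exact: AE.
have mB : measurable_fun setT (fun x : R * R => B x.1 x.2).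
  rewrite (_ : (fun _ => _) = fun x => ((x.2 < x.1)%R%:R%:E * cross x.1 x.2)%E).
    by apply: emeasurable_funM => //; exact/measurable_EFinP.
  by apply/funext => x; rewrite crossC; exact: BE.
have mh : measurable_fun setT (fun s : R =>
    (\1_(`[0, +oo[%classic : set R) s *
      (a1^-1 * (expR (- (a2 * s)) / F s)))%:E).
  apply/measurable_EFinP; apply: measurable_funM; first exact: measurable_indic.
  apply: measurable_funM => //; apply: measurable_funM.
    apply: measurableT_comp => //; apply: measurableT_comp => //.
  exact: measurable_survivalV.
transitivity (\int[mu]_s (\int[mu]_t A s t + \int[mu]_t B s t))%E.
  apply: eq_integral => s _; rewrite -ge0_integralD//.
  - apply: eq_integral => t _; rewrite AE BE [cross t s]crossC.
    by case: (t < s)%R; rewrite ?(subrr, subr0) mul0e mul1e ?add0e ?adde0.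
  - exact: (measurableT_comp mA (pair1_measurable s)).
  - exact: (measurableT_comp mB (pair1_measurable s)).
rewrite ge0_integralD//; last 4 first.
- by move=> s _; exact: integral_ge0.
- exact: (measurable_fun_fubini_tonelli_F (m2 := mu) (fun x => A x.1 x.2)).
- by move=> s _; exact: integral_ge0.
- exact: (measurable_fun_fubini_tonelli_F (m2 := mu) (fun x => B x.1 x.2)).
(* Exchanging the order in the second part makes the earlier time the outer variable. Both parts
   then have the form of [half] and contribute equally, whence the factor 2. *)
rewrite [X in (_ + X)%E](fubini_tonelli (m1 := mu) (m2 := mu)
  (fun x => B x.1 x.2))//=.
under eq_integral do rewrite /A half.
under [X in (_ + X)%E]eq_integral do rewrite /B half.
rewrite -ge0_integralD//.
- rewrite [RHS]integral_mkcond; apply: eq_integral => s _.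
  rewrite patchE indicE; case: ifPn => _; last by rewrite !mul0r adde0.
  by rewrite -EFinD; congr (_%:E); rewrite !mul1r; ring.
- by move=> s _; rewrite -(half true) integral_ge0// => t _; exact: A0.
- by move=> s _; rewrite -(half true) integral_ge0// => t _; exact: A0.
Qed.

End randomized_moments.

(** * The objective as an integral over the survival function *)

(** Var X + (E X)^2 = E X^2, written as a sum so that it makes sense also when the second moment is
    infinite. *)
Lemma variance_ge0_eq_off_null d (T : measurableType d) (R : realType)
    (P : probability T R) (X : T -> R) (K : T -> \bar R) (N : set T) (m : R) :
  measurable N -> P N = 0%E ->
  (forall x, 0 <= X x) -> (forall x, (0 <= K x)%E) -> measurable_fun setT K ->
  (forall x, ~ N x -> (X x)%:E = K x) ->
  (\int[P]_x K x = m%:E)%E ->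
  (variance P X + (m ^+ 2)%:E = \int[P]_x (K x * K x))%E.
Proof.
move=> mN PN X0 K0 mK XK Km.
(* A real-valued measurable version of [X]. *)
pose Z x := fine (K x) * \1_(~` N) x.
have mZ : measurable_fun setT Z.
  apply: measurable_funM; first exact: (measurableT_comp _ mK).
  by apply: measurable_indic; exact: measurableC.
have XZ x : ~ N x -> X x = Z x.
  by move=> Nx; rewrite /Z indicE mem_set// mulr1 -XK.
have Z0 x : 0 <= Z x by rewrite mulr_ge0 ?fine_ge0// indicE ler0n.
have EX : ('E_P[X] = m%:E)%E.
  rewrite unlock -Km; apply: (ge0_integral_eq_off_null mN PN) => //.
have m0 : 0 <= m.
  by rewrite -lee_fin -Km; exact: integral_ge0.
have EZ : (\int[P]_x (Z x)%:E = m%:E)%E.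
  rewrite -EX unlock; apply: (ge0_integral_eq_off_null mN PN) => //.
  by move=> x Nx; rewrite XZ.
have -> : (\int[P]_x (K x * K x) = \int[P]_x (Z x ^+ 2)%:E)%E.
  apply: (ge0_integral_eq_off_null mN PN) => //.
  - by move=> x; rewrite mule_ge0.
  - by move=> x; rewrite lee_fin sqr_ge0.
  - by move=> x Nx; rewrite -XK// -EFinM -XZ// expr2.
have -> : variance P X = (\int[P]_x ((Z x - m) ^+ 2)%:E)%E.
  rewrite /variance covariance.unlock EX expectation.unlock /=.
  apply: (ge0_integral_eq_off_null mN PN) => //.
  - by move=> x; rewrite lee_fin -expr2 sqr_ge0.
  - by move=> x; rewrite lee_fin sqr_ge0.
  - by move=> x Nx; rewrite -(XZ _ Nx) expr2.
have mZB : measurable_fun setT (fun x => ((Z x - m) ^+ 2)%:E).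
  by apply/measurable_EFinP; apply: measurable_funX; exact: measurable_funB.
have mZ2 : measurable_fun setT (fun x => (Z x ^+ 2)%:E).
  by apply/measurable_EFinP; exact: measurable_funX.
(* With the cross term 2 m Z moved to the left, all terms are nonnegative and their integrals add
   even when infinite. *)
have : (\int[P]_x (((Z x - m) ^+ 2)%:E + (2 * m)%:E * (Z x)%:E) =
    \int[P]_x ((Z x ^+ 2)%:E + (m ^+ 2)%:E))%E.
  apply: eq_integral => x _; rewrite -EFinM -!EFinD; congr (_%:E).
  by ring.
rewrite ge0_integralD//; last 3 first.
- by move=> x _; rewrite lee_fin sqr_ge0.
- by move=> x _; rewrite mule_ge0// lee_fin// mulr_ge0.
- by apply: emeasurable_funM => //; exact/measurable_EFinP.
rewrite ge0_integralZl//; last 3 first.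
- exact/measurable_EFinP.
- by move=> x _; rewrite lee_fin.
- by rewrite lee_fin mulr_ge0.
rewrite EZ -EFinM.
rewrite ge0_integralD//; last 2 first.
- by move=> x _; rewrite lee_fin sqr_ge0.
- by move=> x _; rewrite lee_fin sqr_ge0.
have -> : (\int[P]__ (m ^+ 2)%:E = (m ^+ 2)%:E)%E.
  by rewrite integral_cst//= probability_setT mule1.
case: (\int[P]_x _)%E => [v| |]; case: (\int[P]_x _)%E => [w| |] //= [] H.
by congr (_%:E); move: H; rewrite expr2; lra.
Qed.

(** Layer-cake formula for max(x, 0), which is nonnegative everywhere and equals the identity
    [Q]-almost surely. *)
Lemma expectation_survival (R : realType)
    (Q : probability (measurableTypeR R) R) :
  Q `[0, +oo[%classic = 1%E ->
  ('E_Q[idfun] = \int[@lebesgue_measure R]_(s in `[0%R, +oo[)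
     (fine (Q `]s, +oo[%classic))%:E)%E.
Proof.
move=> Q1.
pose X0 : measurableTypeR R -> R := fun x => Num.max x 0.
have mX0 : measurable_fun setT X0 by exact: measurable_maxr.
pose X : {RV Q >-> R} := HB.pack X0 (isMeasurableFun.Build _ _ _ _ _ mX0).
have X_ge0 x : 0 <= X x by rewrite /X/= /X0 le_max lexx orbT.
have QN : Q (~` `[0, +oo[%classic) = 0%E.
  by rewrite probability_setC// Q1 subee.
transitivity ('E_Q[X])%E.
  rewrite unlock; apply: ae_eq_integral => //.
  - by apply/measurable_EFinP; exact: measurable_id.
  - by apply/measurable_EFinP; exact: mX0.
  exists (~` `[0, +oo[%classic); split.
  - exact: measurableC.
  - exact: QN.
  move=> x /= /not_implyP[_]; apply: contra_not => /=.
  by rewrite in_itv/= andbT => x0; rewrite /X0 max_l.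
rewrite ge0_expectation_ccdf//; apply: eq_integral => s.
rewrite inE/= in_itv/= andbT => s0; rewrite fineK ?fin_num_measure//.
congr (Q _); apply/seteqP; split => x /=;
  by rewrite !in_itv/= !andbT /X0 lt_max (ltNge s 0) s0 /= orbF.
Qed.

(** This turns the problem over laws into one over survival functions, pointwise in [s]. The added
    constant is the squared mean of the estimator, common to all admissible [Q]. *)
Lemma objective_survival d (T : measurableType d) (R : realType)
    (P : probability T R) (G : R -> T -> R) (H : R * T -> R) (N : set T)
    (a1 a2 lam : R) (Q : probability (measurableTypeR R) R) :
  measurable N -> P N = 0%E ->
  (forall s w, 0 <= G s w) ->
  measurable_fun setT H -> (forall z, 0 <= H z) ->
  (forall s w, 0 <= s -> ~ N w -> H (s, w) = G s w) ->
  (forall s, 0 <= s ->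
    (\int[P]_w (G s w)%:E = (expR (- (a1 * s)))%:E)%E) ->
  (forall s t, 0 <= s -> s <= t ->
    (\int[P]_w (G s w * G t w)%:E = (expR (- (a2 * s) - a1 * (t - s)))%:E)%E) ->
  0 < a1 -> 0 < lam -> admissible Q ->
  (objective P G lam Q + ((a1^-1) ^+ 2)%:E =
   \int[@lebesgue_measure R]_(s in `[0%R, +oo[)
     (2 / a1 * (expR (- (a2 * s)) / fine (Q `]s, +oo[%classic)) +
      lam * fine (Q `]s, +oo[%classic))%:E)%E.
Proof.
move=> mN PN G0 mH H0 HG m1 m2 a10 lam0 [Q1 Qpos].
have F0 s : 0 <= s -> 0 < fine (Q `]s, +oo[%classic).
  by move=> s0; rewrite fine_gt0// Qpos//= -ge0_fin_numE// fin_num_measure.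
have {}m1 s : 0 <= s -> (\int[P]_w (H (s, w))%:E = (expR (- (a1 * s)))%:E)%E.
  move=> s0; rewrite -m1//; apply: (ge0_integral_eq_off_null mN PN) => //.
  - by move=> w; rewrite lee_fin.
  - by move=> w; rewrite lee_fin.
  - by move=> w Nw; rewrite HG.
have {}m2 s t : 0 <= s -> s <= t ->
    (\int[P]_w (H (s, w) * H (t, w))%:E =
      (expR (- (a2 * s) - a1 * (t - s)))%:E)%E.
  move=> s0 st; rewrite -m2//; apply: (ge0_integral_eq_off_null mN PN) => //.
  - by move=> w; rewrite lee_fin mulr_ge0.
  - by move=> w; rewrite lee_fin mulr_ge0.
  - by move=> w Nw; rewrite !HG// (le_trans s0).
pose K := sampled_integral Q H.
have K0 z : (0 <= K z)%E by exact: sampled_integral_ge0.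
have mK : measurable_fun setT K by exact: measurable_sampled_integral.
have EK : (\int[indep_prod P Q]_z K z = (a1^-1)%:E)%E.
  exact: sampled_integral_mean.
have [N' [mN' PN' subN']] : {ae indep_prod P Q, forall z, K z \is a fin_num}.
  have : (indep_prod P Q).-integrable setT K.
    apply/integrableP; split => //; under eq_integral do rewrite gee0_abs//.
    by rewrite EK ltry.
  by move=> /(integrable_ae measurableT); apply: filterS => z; exact.
(* [M] collects the exceptional paths and the points where [K] is infinite; there the real-valued
   integral, which sends +oo to 0, may differ from [K]. *)
pose M := N `*` [set: measurableTypeR R] `|` N'.
have mM : measurable M by apply: measurableU => //; exact: measurableX.
have PM : indep_prod P Q M = 0%E.
  apply: null_set_setU => //; first exact: measurableX.
  transitivity (P N * Q setT)%E; first exact: product_measure1E.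
  by rewrite PN mul0e.
have IK z : ~ M z -> (randomized_integral G Q z)%:E = K z.
  move=> Mz; rewrite /randomized_integral /Rintegral.
  rewrite -[RHS]fineK; last first.
    by apply: contrapT => Kz; apply: Mz; right; exact: subN'.
  congr ((fine _)%:E); rewrite /K /sampled_integral integral_mkcond.
  apply: eq_integral => s _; rewrite patchE /sampled indicE; case: ifPn => [|_].
    rewrite inE/= in_itv/= andbT => s0; rewrite mul1r HG// => Nz.
    by apply: Mz; left.
  by rewrite mul0r.
have IG0 z : 0 <= randomized_integral G Q z.
  rewrite fine_ge0//; apply: integral_ge0 => s _.
  by rewrite lee_fin !mulr_ge0// invr_ge0 fine_ge0.
have := variance_ge0_eq_off_null mM PM IG0 K0 mK IK EK.
rewrite (sampled_integral_second_moment mH H0 F0 m2 a10) => V.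
rewrite /objective addeAC [X in (X + _)%E]V expectation_survival//.
have mF : measurable_fun setT (fun s : R => fine (Q `]s, +oo[%classic)).
  exact: measurable_survival.
have mFV : measurable_fun setT (fun s : R => (fine (Q `]s, +oo[%classic))^-1).
  exact: measurable_survivalV.
rewrite -ge0_integralZl_EFin//; last 3 first.
- by move=> s _; rewrite lee_fin fine_ge0.
- by apply/measurable_EFinP; exact: measurable_funTS.
- exact: ltW.
rewrite -ge0_integralD//.
- by move=> s _; rewrite lee_fin !mulr_ge0 ?invr_ge0 ?expR_ge0 ?fine_ge0// ltW.
- apply/measurable_EFinP/measurable_funTS; apply: measurable_funM => //.
  by apply: measurable_funM => //; apply: measurableT_comp => //;
    apply: measurableT_comp.
- by move=> s _; rewrite mule_ge0 ?lee_fin ?fine_ge0// ltW.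
- apply: emeasurable_funM => //.
  by apply/measurable_EFinP; exact: measurable_funTS.
Qed.

(** * Pointwise minimization and uniqueness of the minimizer *)

(** As a function of [x], y^2/x + x decreases up to x = y and increases afterwards, so on ]0, 1] it
    is least at min(1, y). In each case the gap to the minimum factors explicitly, which yields both
    its sign and the equality case. *)
Lemma reciprocal_cost_min (R : realFieldType) (x y : R) :
  0 < y -> 0 < x -> x <= 1 ->
  y ^+ 2 / Num.min 1 y + Num.min 1 y <= y ^+ 2 / x + x ?= iff (x == Num.min 1 y).
Proof.
move=> y0 x0 x1; have xN0 : x != 0 by rewrite gt_eqF.
have [y1|y1] := ltP 1 y.
- have E : y ^+ 2 / x + x - (y ^+ 2 / 1 + 1) = (1 - x) * (y ^+ 2 - x) / x.
    by field.
  have yx : 0 < y ^+ 2 - x by rewrite subr_gt0; nra.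
  split.
    by rewrite -subr_ge0 E !mulr_ge0 ?invr_ge0 ?subr_ge0// ltW// -subr_gt0.
  rewrite eq_sym -subr_eq0 E !mulf_eq0 invr_eq0 (gt_eqF yx) (gt_eqF x0) !orbF.
  by rewrite subr_eq0 eq_sym.
- have E : y ^+ 2 / x + x - (y ^+ 2 / y + y) = (x - y) ^+ 2 / x.
    by field; rewrite xN0 gt_eqF.
  split; first by rewrite -subr_ge0 E divr_ge0 ?sqr_ge0 ?ltW.
  rewrite eq_sym -subr_eq0 E mulf_eq0 invr_eq0 (gt_eqF x0) orbF.
  by rewrite sqrf_eq0 subr_eq0.
Qed.

(** Finiteness of the integral of [f] permits subtraction: the nonnegative function g - f has
    integral zero. *)
Lemma ge0_integral_eq_ae d (T : measurableType d) (R : realType)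
    (mu : {measure set T -> \bar R}) (D : set T) (f g : T -> R) :
  measurable D -> measurable_fun D f -> measurable_fun D g ->
  (forall x, D x -> 0 <= f x) -> (forall x, D x -> f x <= g x) ->
  (\int[mu]_(x in D) (f x)%:E < +oo)%E ->
  (\int[mu]_(x in D) (g x)%:E <= \int[mu]_(x in D) (f x)%:E)%E ->
  {ae mu, forall x, D x -> f x = g x}.
Proof.
move=> mD mf mg f0 fg foo gf.
have gf0 x : D x -> (0 <= (g x - f x)%:E)%E.
  by move=> Dx; rewrite lee_fin subr_ge0 fg.
have mgf : measurable_fun D (fun x => (g x - f x)%:E).
  by apply/measurable_EFinP; exact: measurable_funB.
have I0 : (\int[mu]_(x in D) `|(g x - f x)%:E| = 0)%E.
  apply/eqP; rewrite eq_le; apply/andP; split; last exact: integral_ge0.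
  rewrite (eq_integral (fun x => (g x - f x)%:E)); last first.
    by move=> x; rewrite inE => Dx; rewrite gee0_abs// gf0.
  have : (\int[mu]_(x in D) ((g x - f x)%:E + (f x)%:E) <=
      \int[mu]_(x in D) (f x)%:E)%E.
    by under eq_integral do rewrite -EFinD subrK.
  rewrite ge0_integralD//; last exact/measurable_EFinP.
  have fin : (\int[mu]_(x in D) (f x)%:E)%E \is a fin_num.
    by rewrite ge0_fin_numE// integral_ge0.
  by rewrite -leeBrDr// subee.
have /(ae_eq_integral_abs mu mD mgf).1 := I0.
apply: filterS => x /= H Dx; apply/esym/eqP; rewrite -subr_eq0.
by have [/eqP] := H Dx.
Qed.

Lemma survival_right_continuous (R : realType)
    (Q : probability (measurableTypeR R) R) (s : R) :
  fine (Q `]u, +oo[%classic) @[u --> s^'+] --> fine (Q `]s, +oo[%classic).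
Proof.
pose I0 : measurableTypeR R -> R := idfun.
have mI0 : measurable_fun setT I0 by exact: measurable_id.
pose I : {RV Q >-> R} := HB.pack I0 (isMeasurableFun.Build _ _ _ _ _ mI0).
have := @ccdf_right_continuous _ _ _ Q I s.
by move=> H; apply: fine_cvg; rewrite fineK ?fin_num_measure//; exact: H.
Qed.

(** By right-continuity a difference at [s] would persist on some ]s, s + e[, which is not a null
    set. *)
Lemma survival_ae_eq (R : realType)
    (Q1 Q2 : probability (measurableTypeR R) R) :
  {ae @lebesgue_measure R, forall s, `[0%R, +oo[%classic s ->
    fine (Q1 `]s, +oo[%classic) = fine (Q2 `]s, +oo[%classic)} ->
  forall s, 0 <= s -> fine (Q1 `]s, +oo[%classic) = fine (Q2 `]s, +oo[%classic).
Proof.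
move=> [N [mN N0 subN]] s s0.
apply/eqP; rewrite -subr_eq0; apply/negP => /negP neq0.
have [e /= e0 He] : \forall u \near s^'+,
    fine (Q1 `]u, +oo[%classic) - fine (Q2 `]u, +oo[%classic) != 0.
  by apply: cvgr_neq0 neq0; apply: cvgB; exact: survival_right_continuous.
have : (@lebesgue_measure R `]s, (s + e)%R[%classic <= @lebesgue_measure R N)%E.
  apply: le_measure; rewrite ?inE//= => u.
  rewrite /= in_itv/= => /andP[su use]; apply: subN => /= H.
  have := He u; rewrite H ?subrr ?eqxx; last first.
    by rewrite in_itv/= andbT (le_trans s0 (ltW su)).
  move=> K; suff : false by [].
  by apply: K => //; rewrite /ball_/= distrC gtr0_norm ?subr_gt0// ltrBlDl.
rewrite N0 lebesgue_measure_itv/= lte_fin ltrDl e0 -EFinD lee_fin.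
by rewrite addrAC subrr add0r leNgt e0.
Qed.

Lemma admissible_survival_gt0 (R : realType)
    (Q : probability (measurableTypeR R) R) (s : R) :
  admissible Q -> 0 <= s -> 0 < fine (Q `]s, +oo[%classic).
Proof.
by move=> [_ Qpos] s0; rewrite fine_gt0// Qpos//= -ge0_fin_numE// fin_num_measure.
Qed.

Lemma admissible_survival_lt0 (R : realType)
    (Q : probability (measurableTypeR R) R) (s : R) :
  admissible Q -> s < 0 -> Q `]s, +oo[%classic = 1%E.
Proof.
move=> [Q1 _] s0; apply/eqP; rewrite eq_le probability_le1//= -[X in (X <= _)%E]Q1.
apply: le_measure; rewrite ?inE// => x /=; rewrite !in_itv/= !andbT.
exact: lt_le_trans.
Qed.

Section optimum.
Context d (T : measurableType d) (R : realType) (P : probability T R).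
Variables (G : R -> T -> R) (a1 a2 lam C sigma : R).
Hypotheses (a10 : 0 < a1) (a20 : 0 < a2) (lam0 : 0 < lam).
Local Notation mu := (@lebesgue_measure R).
Local Notation survival Q := (fun s : R => fine (Q `]s, +oo[%classic)).
Let cost (F : R -> R) s := 2 / a1 * (expR (- (a2 * s)) / F s) + lam * F s.
Hypothesis objE : forall Q : probability (measurableTypeR R) R, admissible Q ->
  (objective P G lam Q + C%:E =
   \int[mu]_(s in `[0%R, +oo[) (cost (survival Q) s)%:E)%E.
(** The minimizer before capping at 1, sqrt(2 / (lam a1)) e^(- a2 s / 2); [sigma] is the time at
    which it crosses 1. *)
Let y s := expR (- (1 / 2 * a2 * (s - sigma))).
Hypothesis sigmaE : expR (a2 * sigma) = 2 / (lam * a1).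

Let costE F s : cost F s = lam * (y s ^+ 2 / F s + F s).
Proof.
rewrite /cost /y -expRM_natl.
have -> : expR (2%:R * - (1 / 2 * a2 * (s - sigma))) =
    expR (a2 * sigma) * expR (- (a2 * s)).
  by rewrite -expRD; congr expR; field.
by rewrite sigmaE mulrDr !mulrA; congr (_ * _ * _ + _); field; rewrite !gt_eqF.
Qed.

Variable Qs : probability (measurableTypeR R) R.
Hypothesis Qs_adm : admissible Qs.
Hypothesis QsE : forall s, 0 <= s -> fine (Qs `]s, +oo[%classic) = Num.min 1 (y s).

Let cost_min x s : 0 <= s -> 0 < x -> x <= 1 ->
  cost (survival Qs) s <= cost (fun=> x) s ?= iff
    (x == fine (Qs `]s, +oo[%classic)).
Proof.
move=> s0 x0 x1; rewrite !costE QsE//.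
have [H1 H2] := reciprocal_cost_min (expR_gt0 _ : 0 < y s) x0 x1.
split; first by rewrite ler_pM2l.
by rewrite -H2 (inj_eq (mulfI _))// gt_eqF.
Qed.

Let cost_ge0 Q s : admissible Q -> 0 <= s -> 0 <= cost (survival Q) s.
Proof.
move=> Qadm s0; rewrite costE mulr_ge0 ?(ltW lam0)// addr_ge0 ?fine_ge0//.
by rewrite divr_ge0 ?sqr_ge0 ?fine_ge0.
Qed.

Let measurable_cost Q : admissible Q ->
  measurable_fun (`[0, +oo[%classic : set R) (cost (survival Q)).
Proof.
move=> Qadm; apply: measurable_funTS.
have mF := measurable_survival Q.
have mFV : measurable_fun setT (fun s : R => (fine (Q `]s, +oo[%classic))^-1).
  by apply: measurable_survivalV => s; exact: admissible_survival_gt0.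
apply: measurable_funD; apply: measurable_funM => //.
by apply: measurable_funM => //; apply: measurableT_comp => //;
  apply: measurableT_comp.
Qed.

Let cost_integral_min Q : admissible Q ->
  (\int[mu]_(s in `[0%R, +oo[) (cost (survival Qs) s)%:E <=
   \int[mu]_(s in `[0%R, +oo[) (cost (survival Q) s)%:E)%E.
Proof.
move=> Qadm; apply: ge0_le_integral => //.
- by move=> s /=; rewrite in_itv/= andbT lee_fin => s0; exact: cost_ge0.
- by apply/measurable_EFinP; exact: measurable_cost.
- by apply/measurable_EFinP; exact: measurable_cost.
- move=> s /=; rewrite in_itv/= andbT lee_fin => s0.
  have /= := (cost_min (x := fine (Q `]s, +oo[%classic)) s0 _ _).1; apply.
    exact: admissible_survival_gt0.
  by rewrite -lee_fin fineK ?fin_num_measure// probability_le1.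
Qed.

(* Finiteness of the optimal value, by comparison with the survival function
   [expR (- (1 / 2 * a2 * s))]. *)
Let cost_integral_lty :
  (\int[mu]_(s in `[0%R, +oo[) (cost (survival Qs) s)%:E < +oo)%E.
Proof.
pose r := 1 / 2 * a2; have r0 : 0 < r by rewrite mulr_gt0// divr_gt0.
(* [M] is chosen so that [M] times the exponential density of rate [r] is exactly the cost of the
   survival function e^(- r s). *)
pose M := (2 / a1 + lam) / r.
have M0 : 0 <= M by rewrite divr_ge0 ?addr_ge0 ?divr_ge0// ltW.
apply: (@le_lt_trans _ _ (\int[mu]_(s in `[0%R, +oo[)
    (M%:E * (exponential_pdf r s)%:E))%E); last first.
  rewrite ge0_integralZl//.
  - by rewrite (exponential_tail r0 true (lexx 0)) -EFinM ltry.
  - apply/measurable_EFinP/measurable_funTS; exact: measurable_exponential_pdf.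
  - by move=> s _; rewrite lee_fin exponential_pdf_ge0// ltW.
apply: ge0_le_integral => //.
- by move=> s /=; rewrite in_itv/= andbT lee_fin => s0; exact: cost_ge0.
- by apply/measurable_EFinP; exact: measurable_cost.
- apply/measurable_EFinP/measurable_funTS; apply: measurable_funM => //.
  exact: measurable_exponential_pdf.
- move=> s /=; rewrite in_itv/= andbT -EFinM lee_fin => s0.
  have e1 : expR (- (r * s)) <= 1.
    by rewrite -expR0 ler_expR oppr_le0 mulr_ge0// ltW.
  apply: (le_trans (cost_min s0 (expR_gt0 (- (r * s))) e1).1).
  rewrite /cost exponential_pdfE// /M mulNr.
  have -> : expR (- (a2 * s)) = expR (- (r * s)) ^+ 2.
    by rewrite -expRM_natl; congr expR; rewrite /r; field.
  rewrite le_eqVlt; apply/orP; left; apply/eqP; field.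
  by rewrite !gt_eqF// expR_gt0.
Qed.

Lemma optimal_of_survival : optimal P G lam Qs.
Proof.
split=> //; apply/eqP; rewrite eq_le; apply/andP; split; last first.
  by apply: ereal_inf_lbound; exists Qs.
apply: le_ereal_inf_tmp => _ [Q Qadm <-].
(* The finite constant [C] shifts all objectives equally, so comparing cost integrals suffices. *)
by rewrite -(@leeD2rE _ C%:E)// !objE// cost_integral_min.
Qed.

(** Pointwise domination with equal finite integrals forces equal costs almost everywhere. The
    equality case of [cost_min] then equates the survival functions, first almost everywhere and
    then everywhere, and the rays determine the law. *)
Lemma optimal_unique Q : optimal P G lam Q ->
  forall A, measurable A -> Q A = Qs A.
Proof.
move=> [Qadm Qopt].
have QQs : objective P G lam Q = objective P G lam Qs.
  by rewrite Qopt; case: optimal_of_survival => _ ->.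
have : {ae mu, forall s, `[0%R, +oo[%classic s ->
    cost (survival Qs) s = cost (survival Q) s}.
  apply: ge0_integral_eq_ae => //.
  - exact: measurable_cost.
  - exact: measurable_cost.
  - by move=> s /=; rewrite in_itv/= andbT => s0; exact: cost_ge0.
  - move=> s /=; rewrite in_itv/= andbT => s0.
    have /= := (cost_min (x := fine (Q `]s, +oo[%classic)) s0 _ _).1; apply.
      exact: admissible_survival_gt0.
    by rewrite -lee_fin fineK ?fin_num_measure// probability_le1.
  - by rewrite -!objE// QQs.
move=> H.
have {}H : {ae mu, forall s, `[0%R, +oo[%classic s ->
    fine (Q `]s, +oo[%classic) = fine (Qs `]s, +oo[%classic)}.
  case: H => N [mN N0 subN]; exists N; split => //.
  apply: subset_trans subN => s /=; apply: contra_not => H s0; have s0' := s0.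
  move: s0'; rewrite in_itv/= andbT => s0'.
  apply/eqP; have /= <- := (cost_min (x := fine (Q `]s, +oo[%classic)) s0' _ _).2.
  - by rewrite (H s0).
  - exact: admissible_survival_gt0.
  - by rewrite -lee_fin fineK ?fin_num_measure// probability_le1.
apply: measure_eq_rays => s; last first.
  by rewrite -ge0_fin_numE// fin_num_measure.
have [s0|s0] := leP 0 s; last first.
  transitivity (1%E : \bar R); first exact: admissible_survival_lt0.
  by apply/esym; exact: admissible_survival_lt0.
rewrite -[LHS]fineK ?fin_num_measure// -[RHS]fineK ?fin_num_measure//.
by congr (_%:E); exact: survival_ae_eq.
Qed.

End optimum.

(** * The optimal law: an exponential variable, shifted and clipped at 0 *)

Section clipped_exponential.
Context (R : realType) (r sigma : R).
Hypothesis r0 : 0 < r.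
Local Notation mu := (@lebesgue_measure R).

Lemma exponential_ray (u : R) :
  exponential_prob r `]u, +oo[%classic = (Num.min 1 (expR (- (r * (u)))))%:E.
Proof.
have [u0|u0] := leP 0 u.
  rewrite [LHS](exponential_tail r0 false u0) min_r//.
  by rewrite -expR0 ler_expR oppr_le0 mulr_ge0// ltW.
rewrite min_l; last first.
  by rewrite -expR0 ler_expR oppr_ge0 mulr_ge0_le0// ltW.
rewrite /exponential_prob -(integral_exponential_pdf r0) [LHS]integral_mkcond.
apply: eq_integral => x _; rewrite patchE; case: ifPn => //.
rewrite notin_setE /= in_itv/= andbT => /negP; rewrite -leNgt => xu.
by rewrite lt0_exponential_pdf// (le_lt_trans xu).
Qed.

Let E : probability (measurableTypeR R) R :=
  exponential_distribution_exponential_prob__canonical__probability_measure_Probability r0.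

Let clip : measurableTypeR R -> measurableTypeR R :=
  fun x => Num.max 0 (sigma + x).

Let measurable_clip : measurable_fun setT clip.
Proof. by apply: measurable_maxr => //; exact: measurable_funD. Qed.

HB.instance Definition _ :=
  isMeasurableFun.Build _ _ _ _ clip measurable_clip.

(* The clipping creates the atom at 0 when [sigma < 0]; it is inactive otherwise. *)
Definition clipped_exponential : probability (measurableTypeR R) R :=
  distribution E (clip : {mfun _ >-> _}).

Lemma clipped_exponential_ray (s : R) : 0 <= s ->
  clipped_exponential `]s, +oo[%classic =
  (Num.min 1 (expR (- (r * (s - sigma)))))%:E.
Proof.
move=> s0; rewrite -exponential_ray.
congr exponential_prob; apply/seteqP; split => x /=;
  by rewrite !in_itv/= !andbT /clip lt_max (ltNge s 0) s0 /= ltrBlDl.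
Qed.

Lemma admissible_clipped_exponential : admissible clipped_exponential.
Proof.
split.
  transitivity (E setT); last exact: probability_setT.
  congr exponential_prob; apply/seteqP; split => x //= _.
  by rewrite in_itv/= andbT /clip le_max lexx.
by move=> s s0; rewrite clipped_exponential_ray// lte_fin lt_min ltr01 expR_gt0.
Qed.

(** For sigma >= 0 the clipping acts only on a null set. On rays starting below 0 both laws have
    full mass; on the others the survival functions agree. *)
Lemma clipped_exponential_shifted : 0 <= sigma ->
  shifted_exponential clipped_exponential r sigma.
Proof.
move=> sigma0 A mA.
have msh : measurable_fun setT (fun x : measurableTypeR R => sigma + x).
  exact: measurable_funD.
apply: (measure_eq_rays (m1 := clipped_exponential)
  (m2 := pushforward E _)) mA => s.
  apply: esym; transitivity (Num.min 1 (expR (- (r * (s - sigma)))))%:E.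
    rewrite -exponential_ray; congr exponential_prob.
    by apply/seteqP; split => x /=; rewrite !in_itv/= !andbT ltrBlDl.
  have [s0|s0] := leP 0 s; first exact/esym/clipped_exponential_ray.
  rewrite min_l.
    apply/esym.
    exact: (admissible_survival_lt0 admissible_clipped_exponential).
  rewrite -expR0 ler_expR oppr_ge0 mulr_ge0_le0 ?(ltW r0)// subr_le0.
  exact: ltW (lt_le_trans s0 sigma0).
by rewrite -ge0_fin_numE// fin_num_measure.
Qed.

(** Shifting by [sigma] multiplies the exponential density by e^(r sigma) beyond max(0, sigma). The
    mass there is min(1, e^(r sigma)); the rest is the atom at 0, absent when sigma >= 0. *)
Lemma clipped_exponential_pdf (q : R -> R) :
  (forall s, q s = expR (r * sigma) * (r * expR (- (r * s))) *
     (Num.max 0 sigma < s)%R%:R) ->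
  has_pdf_atom0 clipped_exponential q /\
  (0 <= sigma -> has_pdf clipped_exponential q).
Proof.
move=> qE.
have [s' s'E] : exists s', s' = Num.max 0 sigma by eexists.
have s'0 : 0 <= s' by rewrite s'E le_max lexx.
have mD : measurable (`]s', +oo[%classic : set (measurableTypeR R)) by [].
have qE' x : q x = expR (r * sigma) * (exponential_pdf r \_ `]s', +oo[) x.
  rewrite qE patchE; case: ifPn.
    rewrite inE/= in_itv/= andbT => sx; rewrite -s'E sx mulr1.
    by rewrite exponential_pdfE ?mulNr// (le_trans s'0)// ltW.
  rewrite notin_setE /= in_itv/= andbT => /negP; rewrite -leNgt => xs.
  by rewrite -s'E ltNge xs !mulr0.
have IqE (A : set (measurableTypeR R)) : measurable A ->
    (\int[mu]_(x in A) (q x)%:E =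
     (expR (r * sigma))%:E * E (A `&` `]s', +oo[%classic))%E.
  move=> mA; under eq_integral do rewrite qE' EFinM.
  rewrite ge0_integralZl_EFin ?expR_ge0//; last 2 first.
  - move=> x _; rewrite lee_fin patchE; case: ifP => // _.
    by rewrite exponential_pdf_ge0// ltW.
  - apply/measurable_EFinP/measurable_funTS.
    apply/(measurable_restrictT _ _).1 => //; apply: measurable_funTS.
    exact: measurable_exponential_pdf.
  congr (_ * _)%E.
  rewrite [RHS]/(exponential_prob r _) /exponential_prob integral_mkcondr.
  by apply: eq_integral => x _; rewrite !patchE; case: ifP.
have Ktail : (expR (r * sigma) * expR (- (r * s')))%R = Num.min 1 (expR (r * sigma)).
  rewrite s'E -expRD; have [s0|s0] := leP 0 sigma.
    by rewrite subrr expR0 min_l// -expR0 ler_expR mulr_ge0// ltW.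
  by rewrite mulr0 subr0 min_r// -expR0 ler_expR mulr_ge0_le0 ?ltW.
have Etail u : 0 <= u -> E `]u, +oo[%classic = (expR (- (r * u)))%:E.
  move=> u0; apply: etrans (exponential_ray u) _; rewrite min_r//.
  by rewrite -expR0 ler_expR oppr_le0 mulr_ge0// ltW.
have IqT : (\int[mu]_x (q x)%:E = (Num.min 1 (expR (r * sigma)))%:E)%E.
  by rewrite IqE// setTI Etail// -EFinM Ktail.
have p0 : 0 <= 1 - Num.min 1 (expR (r * sigma)).
  by rewrite subr_ge0 ge_min lexx.
(* The candidate: the missing mass at 0 plus the scaled exponential law restricted to ]s', +oo[. It
   is compared with the clipped law on rays. *)
pose m := measure_add (mscale (NngNum p0) (\d_(0%R : measurableTypeR R)))
  (mscale (NngNum (expR_ge0 (r * sigma))) (mrestr E mD)).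
have mE A : m A = ((1 - Num.min 1 (expR (r * sigma)))%:E *
    \d_(0%R : measurableTypeR R) A +
    (expR (r * sigma))%:E * E (A `&` `]s', +oo[%classic))%E.
  by rewrite /m measure_addE.
have Qm A : measurable A -> clipped_exponential A = m A.
  apply: measure_eq_rays => s; last by rewrite -ge0_fin_numE// fin_num_measure.
  rewrite [RHS]mE diracE.
  have [s0|s0] := leP 0 s.
    rewrite memNset ?mule0 ?add0e; last first.
      by rewrite /= in_itv/= andbT; apply/negP; rewrite -leNgt.
    rewrite (_ : _ `&` _ = `]Num.max s s', +oo[%classic); last first.
      by apply/seteqP; split => x /=; rewrite !in_itv/= !andbT gt_max => /andP.
    rewrite Etail ?le_max ?s0// -EFinM; apply: etrans (clipped_exponential_ray s0) _.
    (* If s < s' then sigma > 0 and s' = sigma, so both sides equal 1; otherwise the exponents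
       agree. *)
    congr (_%:E); have [ss'|s's] := ltP s s'.
      have sigma0 : 0 < sigma.
        by rewrite ltNge; apply/negP => ?; move: ss'; rewrite s'E max_l// ltNge s0.
      move: ss'; rewrite Ktail s'E max_r ?ltW// => ss'.
      rewrite !min_l//; rewrite -expR0 ler_expR.
        by rewrite mulr_ge0// ltW.
      by rewrite oppr_ge0 mulr_ge0_le0 ?subr_le0// ltW.
    rewrite -expRD min_r; first by congr expR; ring.
    rewrite -expR0 ler_expR oppr_le0 mulr_ge0 ?subr_ge0 ?(ltW r0)//.
    by apply: le_trans s's; rewrite s'E le_max lexx orbT.
  rewrite mem_set ?mule1; last by rewrite /= in_itv/= andbT.
  rewrite setIidr; last first.
    by move=> x /=; rewrite !in_itv/= !andbT; apply: lt_trans; exact: lt_le_trans s'0.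
  rewrite Etail// -EFinM Ktail -EFinD subrK.
  exact: (admissible_survival_lt0 admissible_clipped_exponential).
have atom0 : has_pdf_atom0 clipped_exponential q.
  by move=> A mA; rewrite Qm// mE IqT IqE//.
split => // sigma0 A mA; rewrite atom0// IqT min_l.
  by rewrite subee// mul0e add0e.
by rewrite -expR0 ler_expR mulr_ge0// ltW.
Qed.

End clipped_exponential.

(** * Application to the discounted power of an exponential Lévy process *)

(** For lam > 2 / a1, [qstar] has mass sqrt(2 / (lam a1)) < 1 and the optimal law has an atom at 0.
    A genuine density and a shifted exponential law are therefore claimed for lam <= 2 / a1, where
    the atom vanishes. *)
Theorem corollary1 (d : measure_display) (T : measurableType d) (R : realType)
    (P : probability T R) (Y : R -> {RV P >-> R}) (phi : R -> \bar R)
    (beta c lam : R) :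
  let X : R -> T -> R := fun t w => expR (Y t w) in
  let f : R -> R := fun x => x `^ beta in
  let g : R -> R -> R := fun x t => expR (- (c * t)) * f x in
  let phi1 : R -> \bar R := fun b => (phi b - c%:E)%E in
  let phi2 : R -> \bar R := fun b => (phi b - (2 * c)%:E)%E in
  let a1 : R := `|fine (phi1 beta)| in
  let a2 : R := `|fine (phi2 (2 * beta))| in
  let sstar : R := if 2 / a1 <= lam then 0 else - (1 / a2) * ln (1 / 2 * lam * a1) in
  let qstar : R -> R := fun s =>
    a2 * Num.sqrt (1 / (2 * lam * a1)) * expR (- (1 / 2 * a2 * s)) *
    (sstar < s)%R%:R in
  levy_process Y ->
  characteristic_exponent Y phi ->
  0 < c ->
  (phi1 beta < 0)%E ->
  (phi2 (2 * beta)%R < 0)%E ->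
  0 < lam ->
  (exists Q, optimal P (fun s w => g (X s w) s) lam Q) /\
  (forall Q, optimal P (fun s w => g (X s w) s) lam Q ->
    has_pdf_atom0 Q qstar /\
    (lam <= 2 / a1 ->
      has_pdf Q qstar /\ shifted_exponential Q (1 / 2 * a2) sstar)).
Proof.
move=> X f g phi1 phi2 a1 a2 sstar qstar levyY phiY c0 phi1_lt0 phi2_lt0 lam0.
have phi_fin b (k : R) : (phi b - k%:E < 0)%E ->
    exists2 p, phi b = p%:E & p < k.
  move=> phib; have phib_oo : (phi b < +oo)%E.
    by move: phib; case: (phi b) => [p _| |] //; exact: ltry.
  have /fineK phibE := characteristic_exponent_fin_num phiY phib_oo.
  exists (fine (phi b)) => //.
  by move: phib; rewrite -phibE -EFinB lte_fin subr_lt0.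
have [p1 p1E p1c] := phi_fin _ _ phi1_lt0.
have [p2 p2E p2c] := phi_fin _ _ phi2_lt0.
have a1E : a1 = c - p1.
  by rewrite /a1 /phi1 p1E -EFinB /= distrC gtr0_norm// subr_gt0.
have a2E : a2 = 2 * c - p2.
  by rewrite /a2 /phi2 p2E -EFinB /= distrC gtr0_norm// subr_gt0.
have a10 : 0 < a1 by rewrite a1E subr_gt0.
have a20 : 0 < a2 by rewrite a2E subr_gt0.
clearbody a1 a2.
pose G (s : R) (w : T) := g (X s w) s.
have GE s w : G s w = expR (- (c * s)) * expR (beta * Y s w).
  by rewrite /G /g /f /X -expRM [Y s w * _]mulrC.
have G0 s w : 0 <= G s w by rewrite GE mulr_ge0// expR_ge0.
have mexp s : measurable_fun setT (fun w => expR (beta * Y s w)).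
  apply: measurableT_comp => //.
  exact: measurable_funM.
have m1 s : 0 <= s -> (\int[P]_w (G s w)%:E = (expR (- (a1 * s)))%:E)%E.
  move=> s0; under eq_integral do rewrite GE EFinM.
  rewrite ge0_integralZl_EFin ?expR_ge0//; last exact/measurable_EFinP.
  rewrite (levy_exp_moment phiY s0 p1E) -EFinM -expRD a1E.
  by congr (expR _)%:E; ring.
have m2 s t : 0 <= s -> s <= t -> (\int[P]_w (G s w * G t w)%:E =
    (expR (- (a2 * s) - a1 * (t - s)))%:E)%E.
  move=> s0 st.
  (* The discount splits as c (s + t) = 2 c s + c (t - s), which yields the rate 2 c - p2 = a2 up to
     [s] and c - p1 = a1 from [s] to [t]. *)
  transitivity (\int[P]_w ((expR (- (c * (s + t))))%:E *
      (expR (beta * Y s w) * expR (beta * Y t w))%:E))%E.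
    apply: eq_integral => w _; rewrite !GE -EFinM; congr (_%:E).
    by rewrite mulrDr opprD expRD; ring.
  rewrite ge0_integralZl_EFin ?expR_ge0//; last first.
    by apply/measurable_EFinP; exact: measurable_funM.
  rewrite (levy_mixed_moment levyY phiY s0 st p1E p2E) -EFinM -expRD.
  by congr (expR _)%:E; rewrite a1E a2E; ring.
have [N [mN PN subN]] := levy_cadlag levyY.
have [H0 mH0 H0E] : exists2 H : R * T -> R, measurable_fun setT H &
    forall s w, 0 <= s -> ~ N w -> H (s, w) = Y s w.
  apply: right_continuous_jointly_measurable => // w Nw.
  have : cadlag (fun t => Y t w) by apply: contrapT => ?; apply: Nw; exact: subN.
  by case.
(* [G] with [Y] replaced by its jointly measurable modification. *)
pose H (z : R * T) := expR (- (c * z.1)) * expR (beta * H0 z).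
have mH : measurable_fun setT H.
  apply: measurable_funM; apply: measurableT_comp => //.
    by apply: measurableT_comp => //; exact: measurable_funM.
  exact: measurable_funM.
have objE (Q : probability (measurableTypeR R) R) : admissible Q ->
    (objective P G lam Q + ((a1^-1) ^+ 2)%:E =
     \int[@lebesgue_measure R]_(s in `[0%R, +oo[)
       (2 / a1 * (expR (- (a2 * s)) / fine (Q `]s, +oo[%classic)) +
        lam * fine (Q `]s, +oo[%classic))%:E)%E.
  apply: (objective_survival (H := H) mN PN) => //.
  - by move=> z; rewrite mulr_ge0// expR_ge0.
  - by move=> s w ? Nw; rewrite /H H0E// GE.
pose r := 1 / 2 * a2; have r0 : 0 < r by rewrite mulr_gt0// divr_gt0.
have la0 : 0 < 1 / 2 * lam * a1 by rewrite !mulr_gt0.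
(* The shift before truncation at 0, solving e^(a2 sigma) = 2 / (lam a1); its sign decides the case
   in [sstar]. *)
pose sigma := - (1 / a2) * ln (1 / 2 * lam * a1).
have sigmaE : expR (a2 * sigma) = 2 / (lam * a1).
  have -> : a2 * sigma = - ln (1 / 2 * lam * a1).
    by rewrite /sigma; field; rewrite gt_eqF.
  by rewrite expRN lnK// !invfM; field; rewrite !gt_eqF.
have sigma_ge0 : (0 <= sigma) = (lam <= 2 / a1).
  rewrite /sigma mulNr oppr_ge0 pmulr_rle0 ?divr_gt0// -ln1 ler_ln ?posrE//.
  by rewrite ler_pdivlMr//; apply/idP/idP; lra.
have sigma_le0 : (sigma <= 0) = (2 / a1 <= lam).
  rewrite /sigma mulNr oppr_le0 pmulr_rge0 ?divr_gt0// -ln1 ler_ln ?posrE//.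
  by rewrite ler_pdivrMr//; apply/idP/idP; lra.
have sstarE : sstar = Num.max 0 sigma.
  rewrite /sstar -sigma_le0; case: ifPn => [|]; first by move=> /max_l ->.
  by rewrite -ltNge => /ltW /max_r ->.
pose Qs := clipped_exponential sigma r0.
have Qs_adm : admissible Qs by exact: admissible_clipped_exponential.
have QsE s : 0 <= s -> fine (Qs `]s, +oo[%classic) =
    Num.min 1 (expR (- (1 / 2 * a2 * (s - sigma)))).
  by move=> s0; rewrite clipped_exponential_ray.
have qstarE s : qstar s = expR (r * sigma) * (r * expR (- (r * s))) *
    (Num.max 0 sigma < s)%R%:R.
  rewrite /qstar sstarE; congr (_ * _).
  (* Both sides are nonnegative with square 1 / (2 lam a1). Since r = a2 / 2, the constant in
     [qstar] becomes r e^(r sigma). *)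
  have -> : Num.sqrt (1 / (2 * lam * a1)) = expR (r * sigma) / 2.
    rewrite -[RHS]ger0_norm ?divr_ge0 ?expR_ge0// -sqrtr_sqr; congr Num.sqrt.
    rewrite expr_div_n -expRM_natl (_ : 2%:R * (r * sigma) = a2 * sigma).
      by rewrite sigmaE; field; rewrite !gt_eqF.
    by rewrite /r; field.
  by rewrite /r; field.
have [atom0 pdf] := clipped_exponential_pdf r0 qstarE.
split.
  exists Qs.
  exact: (optimal_of_survival (G := G) a10 lam0 objE sigmaE Qs_adm QsE).
move=> Q Qopt.
have QQs := optimal_unique a10 a20 lam0 objE sigmaE Qs_adm QsE Qopt.
split; first by move=> A mA; rewrite QQs// atom0.
rewrite -sigma_ge0 => s0; split; first by move=> A mA; rewrite QQs// pdf.
move=> A mA; rewrite QQs// sstarE max_r//.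
exact: clipped_exponential_shifted.
Qed.
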